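(* Let $k$ be an algebraically closed field of characteristic $p$. Let $C\subset\mathbb A^2_k$ be a reduced curve which is invariant by a foliation $\mathcal F$ on $\mathbb A^2_k$ and assume that $\deg(C)\,(\deg(C)-1)<p$. Then $\mathrm{Sing}(C)\subset\mathrm{Sing}(\mathcal F)$.
   Context: A (codimension one) foliation $\mathcal F$ on $\mathbb A^2_k$ is given by a saturated coherent rank-one subsheaf $T_{\mathcal F}\subset T_{\mathbb A^2_k}$ closed under the Lie bracket; equivalently it is the kernel of a polynomial $1$-form $\omega=A\,dx+B\,dy$ with $A,B\in k[x,y]$ coprime, and $\mathrm{Sing}(\mathcal F)$ is the zero locus of $\omega$. A reduced curve $C=\mathcal Z(f)$ ($f$ square-free) is invariant by $\mathcal F$ if $\omega\wedge\frac{df}{f}$ is a regular $2$-form, i.e. $f$ divides $\omega\wedge df$. $\mathrm{Sing}(C)$ is the set of singular points of $C$, and $\deg(C)=\deg f$. *)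

(* Defs.v *)
From mathcomp Require Import all_boot all_order all_algebra.
From mathcomp Require Export mpoly.

Set Implicit Arguments.
Unset Strict Implicit.
Unset Printing Implicit Defensive.

Import GRing.Theory.
Local Open Scope ring_scope.

Section AffinePlane.
Variable k : fieldType.

(* The coordinates x and y of the plane are 'X_0 and 'X_1. *)
Definition ix : 'I_2 := ord0.
Definition iy : 'I_2 := ord_max.

Implicit Types (f g d : {mpoly k[2]}) (P : 'I_2 -> k).

Definition mpdvd d f : Prop := exists h, f = h * d.

Definition mpcoprime f g : Prop :=
  forall d, mpdvd d f -> mpdvd d g -> d \is a GRing.unit.

(* Excludes f = 0. *)
Definition mpsquarefree f : Prop :=
  forall g, mpdvd (g ^+ 2) f -> g \is a GRing.unit.

(* msize f is the total degree plus one for f != 0. *)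
Definition mpdeg f : nat := (msize f).-1.

(* The form dx_coef dx + dy_coef dy. *)
Record one_form := OneForm {
  dx_coef : {mpoly k[2]};
  dy_coef : {mpoly k[2]} }.

Definition differential f : one_form := OneForm f^`M(ix) f^`M(iy).

(* The 2-form h dx /\ dy is identified with h. *)
Definition wedge (w v : one_form) : {mpoly k[2]} :=
  dx_coef w * dy_coef v - dy_coef w * dx_coef v.

(* The foliation is the kernel of fol_form, which it determines up to a
   nonzero constant factor. *)
Record foliation := Foliation {
  fol_form : one_form;
  fol_coprime : mpcoprime (dx_coef fol_form) (dy_coef fol_form) }.

Definition sing_foliation (F : foliation) P : Prop :=
  (dx_coef (fol_form F)).@[P] = 0 /\ (dy_coef (fol_form F)).@[P] = 0.

(* The curve Z(f) is reduced, so f generates its ideal and its singular points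
   are given by the Jacobian criterion applied to f. *)
Record reduced_curve := ReducedCurve {
  curve_eq : {mpoly k[2]};
  curve_squarefree : mpsquarefree curve_eq }.

Definition curve_deg (C : reduced_curve) : nat := mpdeg (curve_eq C).

Definition sing_curve (C : reduced_curve) P : Prop :=
  [/\ (curve_eq C).@[P] = 0,
      (curve_eq C)^`M(ix).@[P] = 0 &
      (curve_eq C)^`M(iy).@[P] = 0].

Definition invariant_curve (C : reduced_curve) (F : foliation) : Prop :=
  mpdvd (curve_eq C) (wedge (fol_form F) (differential (curve_eq C))).

End AffinePlane.

(* Main.v *)
(* Let w = A dx + B dy, v = A d/dy - B d/dx and f the equation of C.  Since v f is a
   multiple of f, the Tjurina ideal I = (f, f_x, f_y) is stable under v.
   Suppose that v does not vanish at P in Sing(C), say (v x_i)(P) != 0.  If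
   g (x_i - P_i)^n lies in I with g(P) != 0 and 0 < n < p, applying v yields such
   an element with n - 1; descending to n = 0 contradicts that I vanishes at P.
   The descent starts from the discriminant of f with respect to the other
   coordinate: it lies in I and in k[x_i], is nonzero as f is squarefree and
   deg f < p, and has degree at most deg f (deg f - 1) < p. *)
Require Import Defs.
From mathcomp Require Import all_boot all_order all_algebra.
From mathcomp Require Import perm separable ring zify.

Set Implicit Arguments.
Unset Strict Implicit.
Unset Printing Implicit Defensive.

Import GRing.Theory.
Local Open Scope ring_scope.

(** * Weighted degree bounds for determinants and resultants *)

Lemma size_prod_weighted (R : idomainType) (I : finType) (F : I -> {poly R})
    (r w : I -> nat) :
  (forall i, F i != 0 -> (size (F i) + w i <= (r i).+1)%N) ->
  \prod_i F i != 0 ->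
  (size (\prod_i F i)%R + \sum_i w i <= (\sum_i r i).+1)%N.
Proof.
move=> hF nz.
have nzF i : F i != 0.
  by apply: contraNneq nz => F0; rewrite (bigD1 i) //= F0 mul0r.
have hsum : (\sum_i size (F i) + \sum_i w i <= \sum_i r i + #|I|)%N.
  rewrite -sum1_card -!big_split /=; apply: leq_sum => i _.
  by rewrite addn1; apply: hF.
rewrite size_prod; last by move=> i _; apply: nzF.
(* Every factor has size at least one, so the truncated subtraction in [size_prod] is exact. *)
have : (#|I| <= \sum_i size (F i))%N.
  by rewrite -sum1_card; apply: leq_sum => i _; rewrite lt0n size_poly_eq0.
have -> : #|(fun _ : I => true)| = #|I| by apply: eq_card.
lia.
Qed.

(** The column weights in a Leibniz term add up to the sum of all [j], whichever the permutation, so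
    every nonzero term obeys the same degree bound. *)
Lemma size_det_weighted (R : idomainType) n (M : 'M[{poly R}]_n)
    (r : 'I_n -> nat) :
  (forall i j, M i j != 0 -> (size (M i j) + j <= (r i).+1)%N) ->
  (size (\det M) <= (\sum_i r i - \sum_(j < n) j).+1)%N.
Proof.
move=> hM; apply: leq_trans (size_sum _ _ _) _; apply/bigmax_leqP => s _.
rewrite -signr_odd mulr_sign.
have -> (b : bool) (q : {poly R}) : size (if b then - q else q) = size q.
  by case: b; rewrite ?size_polyN.
have [->|nz] := eqVneq (\prod_i M i (s i)) 0; first by rewrite size_poly0.
have := size_prod_weighted (w := fun i => s i) (fun i => @hM i (s i)) nz.
rewrite -(reindex_inj (@perm_inj _ s) (P := xpredT)
  (F := fun i : 'I_n => nat_of_ord i)) /=.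
move: nz; rewrite -size_poly_gt0.
move: (size _) (\sum_i r i)%N (\sum_(j < n) j)%N => a b c; lia.
Qed.

Lemma Sylvester_mxl (R : nzRingType) (p q : {poly R}) i j :
  Sylvester_mx p q (lshift _ i) j = ('X^i * p)`_j.
Proof. by rewrite /Sylvester_mx col_mxEu mxE /= rVpoly_delta mxE. Qed.

Lemma Sylvester_mxr (R : nzRingType) (p q : {poly R}) i j :
  Sylvester_mx p q (rshift _ i) j = ('X^i * q)`_j.
Proof. by rewrite /Sylvester_mx col_mxEd mxE /= rVpoly_delta mxE. Qed.

(** The index [i] is the exponent of the outer variable. Zero coefficients are exempt: their size 0
    plus a large [i] would break the bound. *)
Definition total_deg_le (R : nzRingType) (d : nat) (p : {poly {poly R}}) :=
  forall i, p`_i != 0 -> (size (p`_i)%R + i <= d.+1)%N.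

Lemma total_deg_le_size (R : nzRingType) (p : {poly {poly R}}) d :
  total_deg_le d p -> (size p <= d.+1)%N.
Proof.
move=> hp; have [->|nz_p] := eqVneq p 0; first by rewrite size_poly0.
have := hp (size p).-1; rewrite -lead_coefE lead_coef_eq0 => /(_ nz_p).
have : (0 < size (lead_coef p))%N by rewrite lt0n size_poly_eq0 lead_coef_eq0.
lia.
Qed.

Lemma total_deg_leXnM (R : nzRingType) (p : {poly {poly R}}) d n :
  total_deg_le d p -> total_deg_le (d + n) ('X^n * p).
Proof.
move=> hp i; rewrite coefXnM; case: ltnP => [|le_ni]; first by rewrite eqxx.
by move=> /hp; lia.
Qed.

(** The Sylvester rows are the coefficients of ['X^i * p] and ['X^i * q], of total degrees at most
    [d + i] and [e + i]; these serve as row weights in [size_det_weighted]. *)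
Lemma size_resultant_weighted (R : idomainType) (p q : {poly {poly R}}) d e :
  total_deg_le d p -> total_deg_le e q -> (size (resultant p q) <= (d * e).+1)%N.
Proof.
move=> hp hq; have dp := total_deg_le_size hp; have dq := total_deg_le_size hq.
set m := (size q).-1; set n := (size p).-1.
pose r (i : 'I_(m + n)) :=
  match split i with inl i => (d + i)%N | inr i => (e + i)%N end.
apply: (@leq_trans (\sum_i r i - \sum_(j < m + n) j).+1).
  apply: size_det_weighted => i j.
  case: (splitP i) => i' ei.
    have -> : i = lshift n i' by apply: val_inj.
    by rewrite /r (unsplitK (inl i')) Sylvester_mxl; apply: total_deg_leXnM.
  have -> : i = rshift m i' by apply: val_inj.
  by rewrite /r (unsplitK (inr i')) Sylvester_mxr; apply: total_deg_leXnM.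
rewrite ltnS !big_split_ord /=.
under eq_bigr => i _ do rewrite /r (unsplitK (inl i)).
under [X in (_ + X - _)%N]eq_bigr => i _ do rewrite /r (unsplitK (inr i)).
rewrite !big_split /= !sum_nat_const !card_ord.
have le_nd : (n <= d)%N by rewrite /n -subn1 leq_subLR.
have le_me : (m <= e)%N by rewrite /m -subn1 leq_subLR.
move: (\sum_(i < m) i)%N (\sum_(i < n) i)%N => a b.
(* The weights leave [d * m + e * n - m * n], and [d * e] exceeds it by [(d - n) * (e - m)], which
   is nonnegative. *)
rewrite -(subnKC le_nd) -(subnKC le_me).
nia.
Qed.

(** * Square factors and the discriminant over [k[x]] *)

Lemma map_horner_eq0 (R : fieldType) (a : R) (w : {poly {poly R}}) :
  map_poly (horner_eval a) w = 0 -> exists w', w = ('X - a%:P) *: w'.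
Proof.
move=> w0; exists (map_poly (fun c => c %/ ('X - a%:P)) w).
apply/polyP => i; rewrite coefZ coef_map_id0 ?div0p // mulrC.
rewrite divpK // dvdp_XsubCl rootE.
by rewrite -[_.[a]]/(horner_eval a w`_i) -coef_map w0 coef0.
Qed.

(* Gauss' lemma for squares: the roots of c are removed one by one. *)
Lemma square_factor_primitive (k : closedFieldType) (c : {poly k})
    (f w h : {poly {poly k}}) :
  c != 0 -> c *: f = h * w ^+ 2 ->
  exists w' h', f = h' * w' ^+ 2 /\ size w' = size w.
Proof.
have [n] := ubnP (size c); elim: n c w h => // n IHn c w h le_cn nz_c eq_f.
have [sz1|nc_c] := eqVneq (size c) 1%N.
  have /size_poly1P[a nz_a ec] : size c == 1%N by rewrite sz1.
  exists w, (a^-1%:P *: h); split=> //.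
  by rewrite -scalerAl -eq_f ec scalerA -polyCM mulVf // scale1r.
have /closed_rootP [a /factor_theorem[c' ec]] := nc_c.
have nz_c' : c' != 0 by apply: contraNneq nz_c => c0; rewrite ec c0 mul0r.
have nzX : 'X - a%:P != 0 :> {poly k} by rewrite polyXsubC_eq0.
have szc : (size c' < n)%N.
  move: le_cn; rewrite ec size_Mmonic ?monicXsubC // size_XsubC addn2 /=.
  by rewrite !ltnS.
have : map_poly (horner_eval a) h * map_poly (horner_eval a) w ^+ 2 = 0.
  rewrite -rmorphXn -rmorphM /= -eq_f map_polyZ ec rmorphM /=.
  by rewrite /horner_eval hornerXsubC subrr mulr0 scale0r.
have canc (u v : {poly {poly k}}) : ('X - a%:P) *: u = ('X - a%:P) *: v -> u = v.
  by rewrite -!mul_polyC => /mulfI; apply; rewrite polyC_eq0.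
move/eqP; rewrite mulf_eq0 expf_eq0 /= => /orP[] /eqP /map_horner_eq0[u eu].
  apply: IHn szc nz_c' _; last apply: canc.
  by rewrite scalerA mulrC -ec eq_f eu -scalerAl.
have -> : size w = size u by rewrite eu size_scale.
(* Here the square contributes ['X - a%:P] twice: one copy cancels against [c], the other is
   absorbed in [h]. *)
apply: (IHn c' u (('X - a%:P) *: h)) => //; apply: canc.
by rewrite scalerA mulrC -ec eq_f eu exprZn -scalerAr -scalerAl scalerA expr2.
Qed.

(** The witness [s] is the resultant of [f] and its derivative in the outer variable, unless one of
    them is already constant there. *)
Lemma elimination_bound (k : closedFieldType) (p d : nat) (f : {poly {poly k}}) :
  p \in [pchar k] -> (d < p)%N -> (d * d.-1 < p)%N -> f != 0 ->
  (forall w h : {poly {poly k}}, f = h * w ^+ 2 -> (size w <= 1)%N) ->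
  total_deg_le d f ->
  exists s : {poly k}, [/\ s != 0, (size s <= p)%N &
    exists a b, s%:P = a * f + b * f^`()].
Proof.
move=> hp lt_dp lt_ddp nz_f sqf wf.
have szf := total_deg_le_size wf.
have nzn n : (0 < n < p)%N -> n%:R != 0 :> {poly k}.
  move=> /andP[n0 np]; rewrite -polyC_natr polyC_eq0 -(dvdn_pcharf hp).
  by rewrite gtnNdvd.
(* The top coefficient of the derivative is that of [u] times the degree of [u], an integer between
   1 and [p - 1]. *)
have der_nz (u : {poly {poly k}}) : (1 < size u <= size f)%N -> u^`() != 0.
  move=> /andP[szu1 szuf].
  have szp : (size u <= p)%N by rewrite (leq_trans szuf) ?(leq_trans szf).
  apply/eqP => /(congr1 (fun q : {poly _} => q`_(size u).-2)).
  rewrite coef_deriv coef0 -mulr_natr; apply/eqP.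
  rewrite -[_.-2.+1]/((size u).-1.-1.+1) prednK; last by rewrite -subn1 subn_gt0.
  rewrite -lead_coefE mulf_neq0 ?lead_coef_eq0 ?nzn //.
    by rewrite -size_poly_gt0 (ltn_trans _ szu1).
  by case: (size u) szu1 szp => [|[|n]].
have wf' : total_deg_le d.-1 f^`().
  move=> i; rewrite coef_deriv => nz.
  have nz' : f`_i.+1 != 0 by apply: contraNneq nz => ->; rewrite mul0rn.
  have := wf _ nz'.
  have : (size (f`_i.+1 *+ i.+1)%R <= size (f`_i.+1)%R)%N.
    by rewrite -mulr_natr -polyC_natr mulrC mul_polyC size_scale_leq.
  have : (0 < size (f`_i.+1)%R)%N by rewrite size_poly_gt0.
  move: (size _) (size _) => a b; lia.
have const (q : {poly {poly k}}) e : (e < p)%N -> total_deg_le e q -> size q = 1%N ->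
    exists s : {poly k}, [/\ s != 0, (size s <= p)%N & s%:P = q].
  move=> lt_ep wq /eqP /size_poly1P[s nz_s eq]; exists s; split=> //.
  by have := wq 0; rewrite eq coefC /= addn0 => /(_ nz_s) /leq_trans; apply.
(* [resultant_in_ideal] asks for two nonconstant polynomials; a constant one is itself a suitable
   [s]. *)
have [sf1|sf1] := leqP (size f) 1.
  have [|s [nz_s sz_s es]] := const f d lt_dp wf.
    by apply/eqP; rewrite eqn_leq sf1 size_poly_gt0.
  by exists s; split=> //; exists 1, 0; rewrite es; ring.
have nz_f' : f^`() != 0 by apply: der_nz; rewrite sf1 /=.
have [sf1'|sf1'] := leqP (size f^`()) 1.
  have [||s [nz_s sz_s es]] := const f^`() d.-1 _ wf'; first by lia.
    by apply/eqP; rewrite eqn_leq sf1' size_poly_gt0.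
  by exists s; split=> //; exists 0, 1; rewrite es; ring.
have [[u v] /= _ er] := resultant_in_ideal sf1 sf1'.
exists (resultant f f^`()); split; last by exists u, v.
  rewrite resultant_eq0 -leqNgt.
  suff : separable_poly f.
    by rewrite separable_poly.unlock /= coprimep_def => /eqP ->.
  (* Separability splits into squarefreeness and nonzero derivatives of nonconstant divisors; the
     latter is [der_nz]. *)
  apply/separable_polyP; split=> [|u' uf szu]; last first.
    by apply: der_nz; rewrite szu dvdp_leq.
  apply/poly_square_freeP => w; apply: contra => wf2.
  have nz_w : w != 0.
    by apply: contraNneq nz_f => w0; move: wf2; rewrite w0 expr0n dvd0p.
  (* Divisibility here is only up to a nonzero scalar [c] in [{poly k}], which must be removed
     before [sqf] applies. *)
  move: wf2; rewrite Pdiv.Idomain.dvdp_eq => /eqP; set c := _ ^+ _ => ef.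
  have nz_c : c != 0 by rewrite !expf_neq0 // lead_coef_eq0 expf_neq0.
  have [w' [h' [ef' szw]]] := square_factor_primitive nz_c ef.
  by rewrite eqn_leq size_poly_gt0 nz_w andbT -szw (sqf _ _ ef').
by apply: leq_trans (size_resultant_weighted wf wf') _.
Qed.

(** * Bivariate polynomials as iterated polynomials *)

Lemma mderivXU (R : nzRingType) n (l m : 'I_n) :
  ('X_m)^`M(l) = (m == l)%:R :> {mpoly R[n]}.
Proof.
rewrite mderivX mnm1E; case: eqP => [->|_]; last by rewrite scale0r.
have -> : (U_(l) - U_(l))%MM = 0%MM by apply/mnmP => a; rewrite mnmBE subnn mnm0E.
by rewrite scale1r mpolyX0.
Qed.

Section Bivariate.
Variables (k : fieldType) (i j : 'I_2).
Hypothesis ij : i != j.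
Implicit Types f : {mpoly k[2]}.

Lemma ord2_cases l : l = i \/ l = j.
Proof.
case: (eqVneq l i) => [|li]; [by left | right]; apply: val_inj.
move: ij li; rewrite -!val_eqE /=; have := ltn_ord i; have := ltn_ord j.
have := ltn_ord l; lia.
Qed.

(* [k[x_0, x_1]] seen as [k[x_i][x_j]]. *)
Definition to_bipoly : {rmorphism {mpoly k[2]} -> {poly {poly k}}} :=
  mmap (polyC \o polyC) (fun l => if l == i then 'X%:P else 'X).

Definition mpoly_of_poly : {rmorphism {poly k} -> {mpoly k[2]}} :=
  horner_morph (f := @mpolyC 2 k) (u := 'X_i) (fun x => mulrC _ _).

Definition of_bipoly : {rmorphism {poly {poly k}} -> {mpoly k[2]}} :=
  horner_morph (f := mpoly_of_poly) (u := 'X_j) (fun x => mulrC _ _).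

Lemma to_bipolyC c : to_bipoly c%:MP = c%:P%:P.
Proof. by rewrite /to_bipoly /= mmapC. Qed.

Lemma to_bipolyX l : to_bipoly 'X_l = if l == i then 'X%:P else 'X.
Proof. by rewrite /to_bipoly /= mmapX mmap1U. Qed.

Lemma of_bipolyC s : of_bipoly s%:P = mpoly_of_poly s.
Proof. by rewrite /of_bipoly /= horner_morphC. Qed.

Lemma to_bipolyK : cancel to_bipoly of_bipoly.
Proof.
move=> f; rewrite -[in RHS](comp_mpoly_id f).
rewrite /to_bipoly /= /comp_mpoly /mmap rmorph_sum /=; apply: eq_bigr => m _.
rewrite rmorphM /= of_bipolyC /mpoly_of_poly /= horner_morphC; congr (_ * _).
rewrite /mmap1 rmorph_prod /=; apply: eq_bigr => l _.
rewrite rmorphXn /= tnth_mktuple; congr (_ ^+ _).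
case: (ord2_cases l) => ->.
  by rewrite eqxx of_bipolyC /mpoly_of_poly /= horner_morphX.
by rewrite eq_sym (negPf ij) /of_bipoly /= horner_morphX.
Qed.

Lemma of_bipolyK : cancel of_bipoly to_bipoly.
Proof.
have toi s : to_bipoly (mpoly_of_poly s) = s%:P.
  elim/poly_ind: s => [|s c IH]; first by rewrite !rmorph0.
  rewrite !rmorphD !rmorphM /= IH /mpoly_of_poly /= horner_morphC horner_morphX.
  by rewrite to_bipolyC to_bipolyX eqxx.
elim/poly_ind => [|q c IH]; first by rewrite !rmorph0.
rewrite !rmorphD !rmorphM /= IH of_bipolyC toi /of_bipoly /= horner_morphX.
by rewrite to_bipolyX eq_sym (negPf ij).
Qed.

Lemma to_bipoly_deriv f : to_bipoly f^`M(j) = (to_bipoly f)^`().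
Proof.
elim/mpolyind: f => [|c m f _ _ IH]; first by rewrite mderiv0 !rmorph0 deriv0.
rewrite mderivD !rmorphD derivD /= IH mderivZ; congr (_ + _).
rewrite -!mul_mpolyC !rmorphM /= to_bipolyC derivM derivC mul0r add0r.
congr (_ * _).
have dU l : to_bipoly ('X_l)^`M(j) = (to_bipoly 'X_l)^`().
  rewrite mderivXU to_bipolyX; case: (ord2_cases l) => ->.
    by rewrite (negPf ij) eqxx rmorph0 derivC.
  by rewrite eqxx eq_sym (negPf ij) derivX rmorph1.
(* [good] is stable under products, so it passes from the variables to all monomials. *)
pose good g := to_bipoly g^`M(j) = (to_bipoly g)^`().
have good1 : good 1 by rewrite /good rmorph1 -mpolyC1 mderivC rmorph0 derivC.
have goodM g h : good g -> good h -> good (g * h).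
  by rewrite /good mderivM rmorphD !rmorphM /= => -> ->; rewrite derivM.
rewrite -/(good _) mpolyXE_id; elim/big_ind: _ => // l _.
elim: (m l) => [|n IHn]; first by rewrite expr0.
by rewrite exprS; apply: goodM.
Qed.

Lemma total_deg_le_to_bipoly f d :
  (msize f <= d.+1)%N -> total_deg_le d (to_bipoly f).
Proof.
(* This form of the bound passes to sums, hence can be checked on monomials; for [n > d] it says
   that the coefficient vanishes. *)
move=> szf n; suff: (size ((to_bipoly f)`_n)%R <= d.+1 - n)%N.
  move=> szn; rewrite -size_poly_gt0 => /leq_trans/(_ szn).
  by move: (size _) szn => a; lia.
rewrite /to_bipoly /= /mmap coef_sum; apply: leq_trans (size_sum _ _ _) _.
apply/bigmax_leqP_seq => m m_f _.
have -> : mmap1 (fun l => if l == i then 'X%:P else 'X) m =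
    ('X^(m i))%:P * 'X^(m j) :> {poly {poly k}}.
  have ji : j != i by rewrite eq_sym.
  rewrite /mmap1 (bigD1 i) //= eqxx (bigD1 j) //= (negPf ji).
  rewrite big1 ?mulr1 ?rmorphXn // => l /andP[li lj].
  by case: (ord2_cases l) li lj => ->; rewrite eqxx.
rewrite [(_ \o _) _]/= mulrA -polyCM coefCM coefXn.
case: eqP => [->|_]; last by rewrite mulr0 size_poly0.
rewrite mulr1 mul_polyC.
apply: leq_trans (size_scale_leq _ _) _; rewrite size_polyXn.
have : (mdeg m < d.+1)%N by apply: leq_trans (msize_mdeg_lt m_f) szf.
rewrite mdegE (bigD1 i) //= (bigD1 j) /= 1?eq_sym //.
lia.
Qed.

End Bivariate.

Arguments to_bipoly {k} i.
Arguments mpoly_of_poly {k} i.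
Arguments of_bipoly {k} i j.

(** Squarefreeness and the resulting identity are carried across the isomorphism [to_bipoly i], with
    [x_j] as the eliminated variable. *)
Lemma elimination_mpoly (k : closedFieldType) (p : nat) (i j : 'I_2)
    (f : {mpoly k[2]}) :
  p \in [pchar k] -> i != j -> mpsquarefree f ->
  (mpdeg f < p)%N -> (mpdeg f * (mpdeg f).-1 < p)%N ->
  exists s : {poly k}, [/\ s != 0, (size s <= p)%N &
    exists a b, mpoly_of_poly i s = a * f + b * f^`M(j)].
Proof.
move=> hp ij sqf lt_dp lt_ddp.
have nz_f : f != 0.
  apply/eqP => f0; have := sqf 0; rewrite unitr0 f0 expr0n => H.
  by have // : false by apply: H; exists 0; rewrite mulr0.
have wf : total_deg_le (mpdeg f) (to_bipoly i f).
  by apply: (total_deg_le_to_bipoly ij); rewrite /mpdeg leqSpred.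
have [|w h ef|s [nz_s sz_s [a [b es]]]] := elimination_bound hp lt_dp lt_ddp _ _ wf.
- by rewrite -(rmorph0 (to_bipoly i)) (can_eq (to_bipolyK ij)).
- have : of_bipoly i j w \is a GRing.unit.
    apply: sqf; exists (of_bipoly i j h).
    by rewrite -rmorphXn -rmorphM -ef to_bipolyK.
  move/(rmorph_unit (to_bipoly i)); rewrite /= of_bipolyK // poly_unitE.
  by case/andP => /eqP ->.
exists s; split=> //; exists (of_bipoly i j a), (of_bipoly i j b).
rewrite -(of_bipolyC i j) es rmorphD !rmorphM /= -(to_bipoly_deriv ij).
by rewrite !(to_bipolyK ij).
Qed.

(** * The Tjurina ideal and the descent on the exponent *)

Section TjurinaIdeal.
Variables (k : fieldType) (f A B : {mpoly k[2]}).
Implicit Types g h : {mpoly k[2]}.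

Definition tjurina g :=
  exists a b c, g = a * f + b * f^`M(ix) + c * f^`M(iy).

(* The vector field generating the kernel of A dx + B dy. *)
Definition vfield g := A * g^`M(iy) - B * g^`M(ix).

Lemma vfieldM g h : vfield (g * h) = vfield g * h + g * vfield h.
Proof. by rewrite /vfield !mderivM; ring. Qed.

Lemma tjurinaD g h : tjurina g -> tjurina h -> tjurina (g + h).
Proof.
move=> [a [b [c ->]]] [a' [b' [c' ->]]].
by exists (a + a'), (b + b'), (c + c'); ring.
Qed.

Lemma tjurinaM g h : tjurina h -> tjurina (g * h).
Proof.
by move=> [a [b [c ->]]]; exists (g * a), (g * b), (g * c); ring.
Qed.

(** Differentiate [vfield f = q * f] along each variable: commuting [vfield] with a partial
    derivative only adds multiples of [f_x] and [f_y], so [vfield] maps both of them into the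
    ideal. *)
Lemma tjurina_vfield g :
  mpdvd f (vfield f) -> tjurina g -> tjurina (vfield g).
Proof.
move=> [q ef] [a [b [c ->]]].
have deriv_f l : vfield f^`M(l) = q^`M(l) * f + q * f^`M(l)
    - A^`M(l) * f^`M(iy) + B^`M(l) * f^`M(ix).
  have := congr1 (mderiv l) ef; rewrite {1}/vfield mderivB !mderivM.
  rewrite ![_^`M(_)^`M(l)]mderiv_comm => e.
  rewrite -e /vfield; ring.
have vD g1 g2 : vfield (g1 + g2) = vfield g1 + vfield g2.
  by rewrite /vfield !mderivD; ring.
rewrite !vD !vfieldM !deriv_f ef.
exists (vfield a + a * q + b * q^`M(ix) + c * q^`M(iy)),
  (vfield b + b * q + b * B^`M(ix) + c * B^`M(iy)),
  (vfield c + c * q - b * A^`M(ix) - c * A^`M(iy)).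
ring.
Qed.

Lemma tjurina_descent (P : 'I_2 -> k) (i : 'I_2) (c : k) n g :
  mpdvd f (vfield f) -> (vfield 'X_i).@[P] != 0 ->
  (forall m, (0 < m <= n)%N -> m%:R != 0 :> k) ->
  tjurina (g * ('X_i - c%:MP) ^+ n) -> g.@[P] != 0 ->
  exists2 h, tjurina h & h.@[P] != 0.
Proof.
move=> inv_f nz_v; elim: n g => [|n IHn] g nzn tg nz_g.
  by exists g; rewrite // -[g]mulr1.
have nz_n : (n.+1)%:R != 0 :> k by apply: nzn; rewrite leqnn.
have vX m : vfield (('X_i - c%:MP) ^+ m.+1) =
    (m.+1)%:R * vfield 'X_i * ('X_i - c%:MP) ^+ m.
  elim: m => [|m IHm].
    by rewrite expr1 expr0 /vfield !mderivB !mderivC; ring.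
  rewrite exprS vfieldM IHm [(m.+2)%:R]mulrS exprS.
  by rewrite /vfield !mderivB !mderivC; ring.
(* With [t = x_i - c], subtracting [vfield g * g * t^(n+1)] from [g * vfield (g * t^(n+1))] cancels
   the term in [vfield g]; the remaining cofactor of [t^n] is a product of factors nonzero at
   [P]. *)
apply: (IHn ((n.+1)%:R * vfield 'X_i * g ^+ 2)) => [m /andP[m0 mn]||].
- by apply: nzn; rewrite m0 ltnW.
- have -> : (n.+1)%:R * vfield 'X_i * g ^+ 2 * ('X_i - c%:MP) ^+ n =
      g * vfield (g * ('X_i - c%:MP) ^+ n.+1)
      + (- vfield g) * (g * ('X_i - c%:MP) ^+ n.+1).
    by rewrite vfieldM vX; ring.
  by apply: tjurinaD; apply: tjurinaM => //; apply: tjurina_vfield.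
- by rewrite expr2 !mevalM -mpolyC_nat mevalC !mulf_neq0.
Qed.

End TjurinaIdeal.

(** * Singular points of the curve as zeros of the vector field *)

Lemma vfield_coord_sing (k : closedFieldType) (p : nat) (f A B : {mpoly k[2]})
    (P : 'I_2 -> k) (i j : 'I_2) :
  p \in [pchar k] -> i != j -> mpsquarefree f ->
  (mpdeg f * (mpdeg f - 1) < p)%N -> mpdvd f (vfield A B f) ->
  f.@[P] = 0 -> f^`M(ix).@[P] = 0 -> f^`M(iy).@[P] = 0 ->
  (vfield A B 'X_i).@[P] = 0.
Proof.
move=> hp ij sqf lt_ddp inv_f fP fxP fyP; rewrite subn1 in lt_ddp.
have p2 : (1 < p)%N by apply: prime_gt1; apply: pcharf_prime hp.
have lt_dp : (mpdeg f < p)%N.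
  (* For [d >= 2] one has [d <= d * (d - 1)]; for [d <= 1] the bound is [1 < p]. *)
  by move: lt_ddp p2; case: (mpdeg f) => [|[|d]] /=; nia.
apply/eqP/negPn/negP => nz_v.
have [s [nz_s sz_s [a [b es]]]] := elimination_mpoly hp ij sqf lt_dp lt_ddp.
(* The descent starts from [s = r * (X - P_i)^n] with [r] nonzero at [P_i]; here [n < p] because
   [size s <= p]. *)
have [n [r]] := multiplicity_XsubC s (P i).
rewrite nz_s /= => nz_r er.
have nz_r0 : r != 0 by apply: contraNneq nz_r => ->; rewrite root0.
have [|||h [a' [b' [c' ->]]]] :=
  @tjurina_descent _ f A B P i (P i) n (mpoly_of_poly i r) inv_f nz_v.
- move=> m /andP[m0 mn]; rewrite -(dvdn_pcharf hp) gtnNdvd //.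
  apply: leq_trans sz_s; rewrite er size_Mmonic ?monic_exp ?monicXsubC //.
  rewrite size_exp_XsubC addnS /= (leq_ltn_trans mn) //.
  by rewrite -[ltnLHS]add0n ltn_add2r size_poly_gt0.
- have tX l : tjurina f f^`M(l).
    have [->|->] : l = ix \/ l = iy by apply: ord2_cases.
      by exists 0, 1, 0; ring.
    by exists 0, 0, 1; ring.
  have -> : mpoly_of_poly i r * ('X_i - (P i)%:MP) ^+ n = a * f + b * f^`M(j).
    rewrite -es er rmorphM rmorphXn rmorphB /=.
    by rewrite horner_morphX horner_morphC.
  apply: tjurinaD; apply: tjurinaM => //.
  by exists 1, 0, 0; ring.
- suff -> : (mpoly_of_poly i r).@[P] = r.[P i] by [].
  elim/poly_ind: (r) => [|q c IH]; first by rewrite rmorph0 meval0 horner0.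
  rewrite rmorphD rmorphM /= mevalD mevalM IH horner_morphX horner_morphC.
  by rewrite mevalXU mevalC hornerMXaddC.
by rewrite !mevalD !mevalM fP fxP fyP !mulr0 !addr0 eqxx.
Qed.

Local Close Scope ring_scope.

Theorem theorem1p3 (k : closedFieldType) (p : nat) (hp : p \in [pchar k]%R)
    (C : reduced_curve k) (F : foliation k) (hinv : invariant_curve C F)
    (hdeg : curve_deg C * (curve_deg C - 1) < p) :
  forall P : 'I_2 -> k, sing_curve C P -> sing_foliation F P.
Proof.
move: hinv hdeg; rewrite /invariant_curve /curve_deg /sing_curve /sing_foliation.
case: C => f sqf; case: F => [[A B] cop] /= hinv hdeg P [fP fxP fyP].
(* Unfolding [wedge] and [differential] turns the invariance hypothesis into
   [mpdvd f (vfield A B f)]. *)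
have v0 i j (ij : i != j) :=
  vfield_coord_sing hp ij sqf hdeg hinv fP fxP fyP.
(* [vfield A B] sends [x] to [-B] and [y] to [A], so its values on the coordinates yield both
   coefficients of the form. *)
split; last first.
  have := v0 ix iy isT; rewrite /vfield !mderivXU /= mevalB !mevalM.
  by rewrite meval0 meval1 mulr0 mulr1 sub0r => /eqP; rewrite oppr_eq0 => /eqP.
have := v0 iy ix isT; rewrite /vfield !mderivXU /= mevalB !mevalM.
by rewrite meval0 meval1 mulr0 mulr1 subr0.
Qed.
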